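(* (Hölder's inequality) Let $p(\cdot), q(\cdot) \in \mathcal{P}_{1}(0,\infty)$. Then for all $f \in \mathfrak{L}^{p'(\cdot), q'(\cdot)}(\mathbb{R}^n)$ and $g \in \mathfrak{L}^{p(\cdot), q(\cdot)}(\mathbb{R}^n)$, \[ \int_{\mathbb{R}^n} |f(x) g(x)|\, dx \leq \left( 1 + \frac{1}{q_{-}} - \frac{1}{q_{+}} \right) \| f \|_{\mathfrak{L}^{p'(\cdot), q'(\cdot)}(\mathbb{R}^n)} \, \| g \|_{\mathfrak{L}^{p(\cdot), q(\cdot)}(\mathbb{R}^n)}. \]
   Context: A variable exponent on $(0,\infty)$ is a measurable function $p(\cdot):(0,\infty)\to(0,\infty)$; put $p_{-}=\operatorname{ess\,inf}_{t\in(0,\infty)}p(t)$ and $p_{+}=\operatorname{ess\,sup}_{t\in(0,\infty)}p(t)$. For $0\le a<\infty$, $\mathcal{P}_{a}(0,\infty)$ is the set of variable exponents with $a<p_{-}\le p_{+}<\infty$. If $p_{-}>1$, the conjugate exponent $p'(\cdot)$ is defined by $\frac{1}{p'(t)}=1-\frac{1}{p(t)}$ (similarly $q'(\cdot)$). For measurable $f$ on $\mathbb{R}^n$, the non-increasing rearrangement is $f^{*}(t)=\inf\{s\ge 0: |\{x\in\mathbb{R}^n:|f(x)|>s\}|\le t\}$, $0<t<\infty$. For $p(\cdot),q(\cdot)\in\mathcal{P}_0(0,\infty)$ put $\rho_{p(\cdot),q(\cdot)}(f)=\int_0^\infty t^{\frac{q(t)}{p(t)}-1}[f^{*}(t)]^{q(t)}\,dt$.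 The variable Lorentz space $\mathfrak{L}^{p(\cdot),q(\cdot)}(\mathbb{R}^n)$ is the set of measurable $f$ with $\rho_{p(\cdot),q(\cdot)}(f)<\infty$, equipped with $\|f\|_{\mathfrak{L}^{p(\cdot),q(\cdot)}}=\inf\{\lambda>0:\rho_{p(\cdot),q(\cdot)}(f/\lambda)\le 1\}$. *)

(* Defs.v *)
From HB Require Import structures.
From mathcomp Require Import all_boot all_order all_algebra.
From mathcomp Require Import all_classical all_reals all_analysis.
From mathcomp Require Import ess_sup_inf.
Set Implicit Arguments.
Unset Strict Implicit.
Unset Printing Implicit Defensive.
Import Order.TTheory GRing.Theory Num.Theory.
Import numFieldNormedType.Exports.
Local Open Scope classical_set_scope.
Local Open Scope ring_scope.

(* Lebesgue measure on R^n, with R^n represented by n.-tuple R.  The Borel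
   measure lebesgue_tuple n is the n-fold product of lebesgue_measure, carried
   along (a, x) |-> a :: x at each step; lebesgue_Rn is its completion, obtained
   in the same way as completed_lebesgue_measure in dimension one. *)
Definition tuple_cons (T : Type) (n : nat) (x : T * n.-tuple T) : n.+1.-tuple T :=
  [tuple of x.1 :: x.2].

Section tuple_product.
Context {R : realType} (n : nat).
Variable m : {sigma_finite_measure set (n.-tuple R) -> \bar R}.

Lemma measurable_tuple_cons :
  measurable_fun [set: R * n.-tuple R] (@tuple_cons R n).
Proof.
exact: (measurable_cons (f := fst) (g := snd) measurable_fst measurable_snd).
Qed.

Definition tuple_product : set (n.+1.-tuple R) -> \bar R :=
  pushforward (@lebesgue_measure R \x m)%E (@tuple_cons R n).

Let tuple_product0 : tuple_product set0 = 0%E.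
Proof. by rewrite /tuple_product /pushforward preimage_set0 measure0. Qed.

Let tuple_product_ge0 A : (0 <= tuple_product A)%E.
Proof. by rewrite /tuple_product /pushforward measure_ge0. Qed.

Let mpre A : measurable A -> measurable (@tuple_cons R n @^-1` A).
Proof. by move=> mA; rewrite -[X in measurable X]setTI; exact: measurable_tuple_cons. Qed.

Let tuple_product_sigma_additive : semi_sigma_additive tuple_product.
Proof.
move=> F mF tF mUF; rewrite /tuple_product /pushforward preimage_bigcup.
apply: measure_semi_sigma_additive.
- by move=> k; exact: mpre.
- apply/trivIsetP => /= i j _ _ ij; rewrite -preimage_setI.
  by move/trivIsetP : tF => /(_ _ _ _ _ ij) ->//; rewrite preimage_set0.
- by rewrite -preimage_bigcup; exact: mpre.
Qed.

HB.instance Definition _ := isMeasure.Build _ _ _ tuple_product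
  tuple_product0 tuple_product_ge0 tuple_product_sigma_additive.

Let tuple_product_sigma_finite : sigma_finite [set: n.+1.-tuple R] tuple_product.
Proof.
have /sigma_finiteP[F [TF ndF Foo]] := sigma_finiteT (@lebesgue_measure R).
have /sigma_finiteP[G [TG ndG Goo]] := sigma_finiteT m.
pose u (x : n.+1.-tuple R) : R * n.-tuple R := (thead x, [tuple of behead x]).
have uK x : u (@tuple_cons R n x) = x.
  by case: x => a s; rewrite /u /tuple_cons /=; congr pair; apply: val_inj.
have mu : measurable_fun setT u.
  apply/measurable_fun_pairP; split; first exact: measurable_tnth.
  exact: measurable_behead.
exists (fun k => u @^-1` (F k `*` G k)).
  apply/esym; rewrite -subTset => x _.
  have [i _ Fi] : (\bigcup_k F k) (u x).1 by rewrite -TF.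
  have [j _ Gj] : (\bigcup_k G k) (u x).2 by rewrite -TG.
  exists (maxn i j) => //; split.
  - by move: Fi; exact/subsetPset/ndF/leq_maxl.
  - by move: Gj; exact/subsetPset/ndG/leq_maxr.
move=> k; have [mF Fk] := Foo k; have [mG Gk] := Goo k; split.
  by rewrite -[X in measurable X]setTI; apply: mu => //; exact: measurableX.
rewrite /tuple_product /pushforward -comp_preimage.
rewrite (_ : u \o _ = id); last by apply/funext => x; exact: uK.
by rewrite preimage_id product_measure1E// lte_mul_pinfty// ge0_fin_numE.
Qed.

HB.instance Definition _ := Measure_isSigmaFinite.Build _ _ _ tuple_product
  tuple_product_sigma_finite.

End tuple_product.

Section lebesgue_Rn.
Context {R : realType}.

Let lebesgue_tuple0 : {sigma_finite_measure set (0.-tuple R) -> \bar R} :=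
  dirac [tuple].

Fixpoint lebesgue_tuple (n : nat) :
    {sigma_finite_measure set (n.-tuple R) -> \bar R} :=
  match n with
  | 0%N => lebesgue_tuple0
  | k.+1 => tuple_product (lebesgue_tuple k)
  end.

Lemma lebesgue_tuple_box (n : nat) (A : 'I_n -> set R) :
  (forall i, measurable (A i)) ->
  lebesgue_tuple n [set x | forall i, A i (tnth x i)] =
    (\prod_(i < n) lebesgue_measure (A i))%E.
Proof.
elim: n A => [|n IHn] A mA.
  rewrite big_ord0 /= diracE mem_set// => -[]//.
rewrite big_ord_recl /= /tuple_product /pushforward.
have mB : measurable [set x : n.-tuple R | forall i, A (lift ord0 i) (tnth x i)].
  rewrite (_ : [set _ | _] =
      \bigcap_(i in [set: 'I_n]) ((@tnth n R)^~ i @^-1` A (lift ord0 i))); last first.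
    by apply/seteqP; split=> x /= h i; [move=> _|]; exact: h.
  apply: fin_bigcap_measurable => // i _.
  by rewrite -[X in measurable X]setTI; exact: measurable_tnth.
have -> : @tuple_cons R n @^-1` [set x | forall i, A i (tnth x i)] =
    A ord0 `*` [set x | forall i, A (lift ord0 i) (tnth x i)].
  apply/seteqP; split=> -[a x] /=.
    move=> h; split=> [|i] /=; first exact: (h ord0).
    by have := h (lift ord0 i); rewrite tnthS.
  by move=> [Aa h] i; case: (unliftP ord0 i) => [j|] ->; rewrite ?tnthS.
rewrite product_measure1E; [|exact: mA|exact: mB].
congr (_ * _)%E.
exact: (IHn (fun i => A (lift ord0 i))).
Qed.

End lebesgue_Rn.

(* R^n and R equipped with the sigma-algebra of Lebesgue (not just Borel)
   measurable sets. *)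
Definition Rn (R : realType) (n : nat) :=
  caratheodory_type ((@lebesgue_tuple R n)^*)%mu.

Definition Rleb (R : realType) := caratheodory_type ((wlength (@idfun R))^*)%mu.

Definition lebesgue_Rn {R : realType} {n : nat} : set (Rn R n) -> \bar R :=
  @completed_measure_extension _ _ R (lebesgue_tuple n).

HB.instance Definition _ (R : realType) (n : nat) :=
  Measure.on (@lebesgue_Rn R n).

Lemma lebesgue_Rn_sigma_finite (R : realType) (n : nat) :
  sigma_finite setT (@lebesgue_Rn R n).
Proof. exact/completed_measure_extension_sigma_finite/sigma_finiteT. Qed.

HB.instance Definition _ (R : realType) (n : nat) :=
  Measure_isSigmaFinite.Build _ _ _ (@lebesgue_Rn R n)
    (@lebesgue_Rn_sigma_finite R n).

Section exponents.
Context {R : realType}.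
Local Open Scope ereal_scope.

Definition Rpos : set (Rleb R) := `]0%R, +oo[.

Lemma measurable_Rpos : measurable Rpos.
Proof.
apply: sub_caratheodory.
by have := @measurable_itv R `]0%R, +oo[.
Qed.

Definition lebesgue_pos := mrestr (@completed_lebesgue_measure R) measurable_Rpos.

HB.instance Definition _ := Measure.on lebesgue_pos.

(* Exponents are functions on R of which only the values on ]0, +oo[ matter. *)
Definition exponent_inf (p : R -> R) : \bar R :=
  ess_inf lebesgue_pos (fun t : Rleb R => (p t)%:E).

Definition exponent_sup (p : R -> R) : \bar R :=
  ess_sup lebesgue_pos (fun t : Rleb R => (p t)%:E).

Definition variable_exponent (p : R -> R) : Prop :=
  measurable_fun Rpos (p : Rleb R -> R) /\ (forall t, 0 < t -> 0 < p t)%R.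

Definition exponent_class (a : R) : set (R -> R) :=
  [set p | [/\ variable_exponent p, a%:E < exponent_inf p,
               exponent_inf p <= exponent_sup p & exponent_sup p < +oo]].

(* When exponent_inf p > 1 one has p t > 1 for almost every t > 0; on the
   remaining null set the value is irrelevant. *)
Definition conjugate_exponent (p : R -> R) (t : R) : R := ((1 - (p t)^-1)^-1)%R.

End exponents.

Section lorentz.
Context {R : realType} {n : nat}.
Local Open Scope ereal_scope.
Implicit Types (p q : R -> R) (f : Rn R n -> R).

(* Valued in \bar R since the infimum of the empty set is +oo. *)
Definition rearrangement f (t : R) : \bar R :=
  ereal_inf [set s%:E | s in
    [set s : R | (0 <= s)%R /\ lebesgue_Rn [set x | (s < `|f x|)%R] <= t%:E]].

Definition lorentz_modular p q f : \bar R :=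
  \int[@completed_lebesgue_measure R]_(t in Rpos)
    ((t `^ (q t / p t - 1))%R%:E * (rearrangement f t) `^ (q t)).

Definition variable_lorentz p q : set (Rn R n -> R) :=
  [set f | measurable_fun setT f /\ lorentz_modular p q f < +oo].

Definition lorentz_norm p q f : \bar R :=
  ereal_inf [set l%:E | l in
    [set l : R | (0 < l)%R /\ lorentz_modular p q (fun x => f x / l)%R <= 1]].

End lorentz.

(* Main.v *)
(* By the layer cake formula and Tonelli, the integral of [|f g|] is the integral
   over [s, u >= 0] of the measure of [{|f| > s} /\ {|g| > u}], which is at most
   the length of the set of [t > 0] lying below both distribution functions.
   Tonelli again turns this bound into the integral of [f^* g^*] (the
   Hardy-Littlewood inequality).  Since [1/p + 1/p' = 1/q + 1/q' = 1], the weights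
   [t^(1/p - 1/q)] and [t^(1/p' - 1/q')] cancel, so Young's inequality with
   exponent [q(t)] bounds [f^* g^*] by the two modular integrands with coefficients
   [1/q(t) <= 1/q_-] and [1 - 1/q(t) <= 1 - 1/q_+].  This settles the case where
   both modulars are at most 1; the general case follows by scaling. *)

Require Import Defs.
From HB Require Import structures.
From mathcomp Require Import all_boot all_order all_algebra.
From mathcomp Require Import all_classical all_reals all_analysis.
From mathcomp Require Import measurable_realfun ess_sup_inf ring lra.
Import Order.TTheory GRing.Theory Num.Theory.
Import numFieldNormedType.Exports.
Local Open Scope classical_set_scope.
Local Open Scope ring_scope.

Set Implicit Arguments.
Unset Strict Implicit.
Unset Printing Implicit Defensive.

(** * Young's inequality with power weights *)

Section weighted_young.
Context {R : realType}.
Implicit Types (p q t : R).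

(** With c = 1/p - 1/q the two weights are t^(c q) and t^(-c q'), so this is the classical Young
    inequality for t^c a and t^(-c) b, whose product is a b. Conjugates are taken of constant
    functions so that the bound at t matches the modular integrands by conversion. *)
Lemma weighted_young p q t (a b : R) : 0 < t -> 1 < q -> 0 <= a -> 0 <= b ->
  b * a <= q^-1 * (t `^ (q / p - 1) * a `^ q) +
    (1 - q^-1) * (t `^ (conjugate_exponent (fun=> q) t /
                         conjugate_exponent (fun=> p) t - 1)
                  * b `^ conjugate_exponent (fun=> q) t).
Proof.
move=> t0 q1 a0 b0; rewrite /conjugate_exponent invrK.
have q0 : 0 < q by exact: lt_trans q1.
have iq0 : 0 < 1 - q^-1 by rewrite subr_gt0 invf_lt1.
set q' := (1 - q^-1)^-1.
have q'0 : 0 < q' by rewrite invr_gt0.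
have -> : q / p - 1 = (p^-1 - q^-1) * q by rewrite mulrBl mulVf ?gt_eqF// mulrC.
have -> : q' * (1 - p^-1) - 1 = - (p^-1 - q^-1) * q'.
  have : q' * (1 - q^-1) = 1 by rewrite /q' mulVf// gt_eqF.
  lra.
set c := p^-1 - q^-1.
rewrite !powRrM -!powRM ?powR_ge0//.
have -> : b * a = (t `^ c * a) * (t `^ (- c) * b).
  rewrite powRN mulrACA divff ?gt_eqF ?powR_gt0//; lra.
have qq' : q^-1 + q'^-1 = 1 by rewrite invrK addrC subrK.
have A0 : 0 <= t `^ c * a by rewrite mulr_ge0 ?powR_ge0.
have B0 : 0 <= t `^ (- c) * b by rewrite mulr_ge0 ?powR_ge0.
have := conjugate_powR A0 B0 q0 q'0 qq'.
by rewrite [X in _ <= _ + X]mulrC [X in _ <= X + _]mulrC invrK.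
Qed.

Local Open Scope ereal_scope.

(** A rearrangement may be infinite. If a or b is +oo, its term on the right is +oo, since the
    coefficient, the weight and the exponent of the power are all positive. *)
Lemma weighted_young_ereal p q t (a b : \bar R) :
  (0 < t)%R -> (1 < q)%R -> 0 <= a -> 0 <= b ->
  b * a <= (q^-1)%:E * ((t `^ (q / p - 1))%R%:E * a `^ q) +
    (1 - q^-1)%:E * ((t `^ (conjugate_exponent (fun=> q) t /
                         conjugate_exponent (fun=> p) t - 1))%R%:E
                  * b `^ conjugate_exponent (fun=> q) t).
Proof.
move=> t0 q1 a0 b0.
have q0 : (0 < q)%R by exact: lt_trans q1.
have iq0 : (0 < 1 - q^-1)%R by rewrite subr_gt0 invf_lt1.
have q'0 : (0 < conjugate_exponent (fun=> q) t)%R.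
  by rewrite /conjugate_exponent invr_gt0.
have ge0 (c x y r : R) (z : \bar R) : (0 < c)%R ->
    0 <= c%:E * ((x `^ y)%R%:E * z `^ r).
  move=> /ltW c0; apply: mule_ge0; first by rewrite lee_fin.
  by apply: mule_ge0; rewrite ?lee_fin ?powR_ge0 ?poweR_ge0.
case: a a0 => [a| |]//.
- case: b b0 => [b| |]//.
  + rewrite !lee_fin => b0 a0; exact: weighted_young.
  + move=> _ _; rewrite (@poweRyr _ (conjugate_exponent _ _)) ?gt_eqF//.
    rewrite gt0_muley ?lte_fin ?powR_gt0// gt0_muley ?lte_fin//.
    by rewrite addey ?leey// gt_eqF// (lt_le_trans ltNy0)// ge0// invr_gt0.
- move=> _; rewrite (@poweRyr _ q) ?gt_eqF//; move: (b * +oo) => ba.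
  rewrite gt0_muley ?lte_fin ?powR_gt0// gt0_muley ?lte_fin ?invr_gt0//.
  by rewrite addye ?leey// gt_eqF// (lt_le_trans ltNy0)// ge0.
Qed.

End weighted_young.

(** * Measurability of powers with variable exponent *)

Section measurability.
Context d (T : measurableType d) (R : realType).
Implicit Types (D : set T).

(** Squaring gives a nonnegative base, for which the real power -1 is the inverse: y^-1 = y
    (y^2)^-1. This also holds at y = 0, where the inverse is 0 by convention. *)
Lemma measurable_fun_inv D (f : T -> R) : measurable_fun D f ->
  measurable_fun D (fun x => (f x)^-1).
Proof.
move=> mf; rewrite (_ : (fun _ => _) = (fun x => f x * (f x ^+ 2) `^ (-1))).
  apply: measurable_funM => //.
  exact: (measurableT_comp (@measurable_powR R (-1)) (measurable_funX 2 mf)).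
apply/funext => x; rewrite powR_inv1 ?sqr_ge0//.
have [->|fx0] := eqVneq (f x) 0; first by rewrite mul0r invr0.
by rewrite expr2 invfM mulrA divff// mul1r.
Qed.

Lemma measurable_fun_powR D (f g : T -> R) :
  measurable_fun D f -> measurable_fun D g ->
  measurable_fun D (fun x => f x `^ g x).
Proof.
move=> mf mg mD; move: (mD); rewrite /powR; apply: measurable_fun_if => //.
- exact: measurable_fun_eqr.
- apply: (@measurable_funS _ _ _ _ D) => //.
  by apply: measurableT_comp => //; exact: measurable_fun_eqr.
- apply: (@measurable_funS _ _ _ _ D) => //.
  apply: measurableT_comp => //; apply: measurable_funM => //.
  exact: measurableT_comp.
Qed.

Lemma measurable_fun_poweR D (f : T -> \bar R) (g : T -> R) :
  measurable_fun D f -> measurable_fun D g ->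
  measurable_fun D (fun x => f x `^ g x)%E.
Proof.
(* Conventions at infinity: exponent 0 gives 1; any other exponent sends +oo to +oo and -oo to 0. *)
move=> mf mg mD; rewrite (_ : (fun _ => _) = (fun x => if f x == +oo%E then
    (if g x == 0%R then 1%E else +oo%E) else if f x == -oo%E then
    (if g x == 0%R then 1%E else 0%E) else (fine (f x) `^ g x)%:E)).
  have mg0 : measurable_fun D (fun x => g x == 0) by exact: measurable_fun_eqr.
  have mif (a b : \bar R) : measurable_fun D (fun x => if g x == 0%R then a else b).
    by apply: measurable_fun_if.
  move: (mD); apply: measurable_fun_if => //.
  - exact: measurable_fun_eqe.
  - exact: (@measurable_funS _ _ _ _ D).
  - apply: (@measurable_funS _ _ _ _ D) => //; apply: measurable_fun_if => //.
    + exact: measurable_fun_eqe.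
    + exact: (@measurable_funS _ _ _ _ D).
    + apply: (@measurable_funS _ _ _ _ D) => //; apply/measurable_EFinP.
      by apply: measurable_fun_powR => //; exact: measurableT_comp.
by apply/funext => x; case: (f x).
Qed.

End measurability.

(** * Tonelli for products of section measures *)

Section section_products.
Context d1 d2 (X : measurableType d1) (Y : measurableType d2) (R : realType).
Variables (mu : {sigma_finite_measure set X -> \bar R}).
Variables (nu : {sigma_finite_measure set Y -> \bar R}).
Implicit Types A B : set (X * Y).
Local Open Scope ereal_scope.

(* An alias is needed because inference on [nu \x nu] itself only finds the
   canonical structure for subprobabilities, not the sigma-finite one. *)
Definition square_measure : set (Y * Y) -> \bar R := nu \x nu.

HB.instance Definition _ := Measure.on square_measure.

Let square_measure_sigma_finite : sigma_finite setT square_measure.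
Proof.
have /sigma_finiteP[F [TF ndF Foo]] := sigma_finiteT nu.
(* If y is in F i and z in F j, then (y, z) is in the square of index max(i, j), because F is
   nondecreasing. *)
exists (fun k => F k `*` F k) => [|k].
  apply/esym; rewrite -subTset => -[y z] _.
  have [i _ Fy] : (\bigcup_k F k) y by rewrite -TF.
  have [j _ Fz] : (\bigcup_k F k) z by rewrite -TF.
  exists (maxn i j) => //; split => /=.
  - by move: Fy; exact/subsetPset/ndF/leq_maxl.
  - by move: Fz; exact/subsetPset/ndF/leq_maxr.
have [mF Fk] := Foo k; split; first exact: measurableX.
by rewrite /square_measure product_measure1E// lte_mul_pinfty// ge0_fin_numE.
Qed.

HB.instance Definition _ := Measure_isSigmaFinite.Build _ _ _ square_measure
  square_measure_sigma_finite.

Let fiber_product A B : set (X * (Y * Y)) :=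
  [set w | A (w.1, w.2.1)] `&` [set w | B (w.1, w.2.2)].

Let measurable_fiber_product A B : measurable A -> measurable B ->
  measurable (fiber_product A B).
Proof.
move=> mA mB; apply: measurableI; rewrite -[X in measurable X]setTI.
- have m : measurable_fun setT (fun w : X * (Y * Y) => (w.1, w.2.1)).
    by apply: measurable_fun_pair => //; exact: measurableT_comp.
  exact: m.
- have m : measurable_fun setT (fun w : X * (Y * Y) => (w.1, w.2.2)).
    by apply: measurable_fun_pair => //; exact: measurableT_comp.
  exact: m.
Qed.

Let ysection_fiber_product A B z :
  ysection (fiber_product A B) z = ysection A z.1 `&` ysection B z.2.
Proof. by apply/seteqP; split=> x /=; rewrite /ysection /= !inE. Qed.

Lemma measurable_fun_ysectionI A B : measurable A -> measurable B ->
  measurable_fun setT (fun z : Y * Y => mu (ysection A z.1 `&` ysection B z.2)).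
Proof.
move=> mA mB.
rewrite (_ : (fun _ => _) = mu \o ysection (fiber_product A B)).
  by apply: measurable_fun_ysection; exact: measurable_fiber_product.
by apply/funext => z /=; rewrite ysection_fiber_product.
Qed.

(** Both sides are the measure of [fiber_product A B] in X * (Y * Y), obtained by slicing at x on
    the left and at (y, z) on the right. *)
Lemma integral_mul_xsection A B : measurable A -> measurable B ->
  \int[mu]_x (nu (xsection A x) * nu (xsection B x)) =
  \int[square_measure]_z mu (ysection A z.1 `&` ysection B z.2).
Proof.
move=> mA mB.
transitivity ((mu \x square_measure) (fiber_product A B)).
  apply: eq_integral => x _ /=.
  rewrite -product_measure1E; [|exact: measurable_xsection..].
  congr (product_measure1 _ _ _).
  by apply/seteqP; split=> -[y z] /=; rewrite /xsection /= !inE.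
(* The two orders of integration agree on rectangles, hence everywhere by uniqueness of the product
   measure. *)
transitivity ((mu \x^ square_measure) (fiber_product A B)).
  apply: product_measure_unique => [C D mC mD|]; last exact: measurable_fiber_product.
  exact: product_measure2E.
by apply: eq_integral => z _ /=; rewrite ysection_fiber_product.
Qed.

End section_products.

(** * Hypographs and the layer cake formula *)

Section hypograph.
Context d (T : measurableType d) (R : realType).
Implicit Types (f : T -> R) (s : R).
Local Open Scope ereal_scope.

(** The region carrying the layer cake formula: the section over x is [0, |f x|[, of length |f x|,
    and the section at height s >= 0 is the superlevel set of |f|. *)
Definition hypograph f : set (T * measurableTypeR R) :=
  [set w | (0 <= w.2 < `|f w.1|)%R].

Lemma measurable_hypograph f : measurable_fun setT f -> measurable (hypograph f).
Proof.
move=> mf.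
have m1 : measurable_fun setT (fun w : T * measurableTypeR R => (0 <= w.2)%R).
  exact: measurable_fun_ler.
have m2 : measurable_fun setT (fun w : T * measurableTypeR R => (w.2 < `|f w.1|)%R).
  apply: measurable_fun_ltr => //.
  apply: (@measurableT_comp _ _ _ _ _ _ (@Num.norm R R)) => //.
  exact: (@measurableT_comp _ _ _ _ _ _ f).
have := measurable_and m1 m2 measurableT.
move=> /(_ [set true]); rewrite setTI; exact.
Qed.

Lemma measurable_superlevel f s : measurable_fun setT f ->
  measurable [set x | (s < `|f x|)%R].
Proof.
move=> mf; rewrite -[X in measurable X]setTI.
have mnf : measurable_fun setT (fun x => `|f x|%R).
  exact: (@measurableT_comp _ _ _ _ _ _ (@Num.norm R R)).
rewrite (_ : [set x | _] = (fun x => `|f x|%R) @^-1` `]s, +oo[).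
  exact: mnf.
by apply/seteqP; split=> x /=; rewrite in_itv/= andbT.
Qed.

Lemma ysection_hypograph f s : (0 <= s)%R ->
  ysection (hypograph f) s = [set x | (s < `|f x|)%R].
Proof.
by move=> s0; apply/seteqP; split=> x /=; rewrite /ysection /hypograph /= inE/= s0.
Qed.

Lemma ysection_hypograph0 f s : (s < 0)%R -> ysection (hypograph f) s = set0.
Proof.
move=> s0; apply/seteqP; split=> x //=; rewrite /ysection /hypograph /= inE/=.
by rewrite leNgt s0.
Qed.

Lemma lebesgue_xsection_hypograph f x :
  lebesgue_measure (xsection (hypograph f) x) = `|f x|%:E.
Proof.
rewrite (_ : xsection _ _ = `[0%R, `|f x|%R[%classic).
  rewrite lebesgue_measure_itv/= lte_fin; case: ifPn => [_|]; first by rewrite sube0.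
  by rewrite normr_gt0 negbK => /eqP ->; rewrite normr0.
by apply/seteqP; split=> s /=; rewrite /xsection /hypograph /= inE/= in_itv.
Qed.

End hypograph.

(** * Rearrangements and the Hardy-Littlewood inequality *)

Section rearrangement_section.
Context {R : realType} {n : nat}.
Implicit Types (f : Rn R n -> R) (s t : R).
Local Open Scope ereal_scope.

Let mu : {sigma_finite_measure set (Rn R n) -> \bar R} := @lebesgue_Rn R n.
Let leb : {sigma_finite_measure set (measurableTypeR R) -> \bar R} :=
  @lebesgue_measure R.
Let cleb : {sigma_finite_measure set (Rleb R) -> \bar R} :=
  @completed_lebesgue_measure R.

(** The points (t, s) with t > 0 below the distribution function of f at s. The section over t has
    length f^*(t); the section at height s is an interval starting at 0 whose length is the
    distribution function. *)
Definition rearrangement_hypograph f : set (Rleb R * measurableTypeR R) :=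
  [set w | (0 < (w.1 : R))%R &&
           ((w.1 : R)%:E < lebesgue_Rn (ysection (hypograph f) w.2))].

Lemma rearrangement_ge0 f t : 0 <= rearrangement f t.
Proof. by apply: le_ereal_inf_tmp => _ [s [s0 _] <-]; rewrite lee_fin. Qed.

Lemma RposE t : Rpos t = (0 < t)%R :> Prop.
Proof. by rewrite /Rpos /= in_itv/= andbT. Qed.

Lemma measurable_itv_Rleb (i : interval R) : measurable ([set` i] : set (Rleb R)).
Proof. by apply: sub_caratheodory; have := @measurable_itv R i. Qed.

Lemma measurable_id_Rleb : measurable_fun setT (id : Rleb R -> measurableTypeR R).
Proof. by move=> _ Y mY; rewrite setTI; exact: sub_caratheodory. Qed.

Lemma measurable_rearrangement_hypograph f : measurable_fun setT f ->
  measurable (rearrangement_hypograph f).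
Proof.
move=> mf.
have mfst : measurable_fun setT
    (fun w : Rleb R * measurableTypeR R => (w.1 : measurableTypeR R)).
  exact: (measurableT_comp measurable_id_Rleb).
have m1 : measurable_fun setT
    (fun w : Rleb R * measurableTypeR R => (0 < (w.1 : R))%R).
  exact: measurable_fun_ltr.
have m2 : measurable_fun setT (fun w : Rleb R * measurableTypeR R =>
    (w.1 : R)%:E < mu (ysection (hypograph f) w.2)).
  apply: measurable_fun_lte; first exact/measurable_EFinP.
  apply: (@measurableT_comp _ _ _ _ _ _ (mu \o ysection (hypograph f))) => //.
  by apply: measurable_fun_ysection; exact: measurable_hypograph.
have := measurable_and m1 m2 measurableT.
move=> /(_ [set true]); rewrite setTI; exact.
Qed.

(** The section lies between [0, f^*(t)[ and [0, f^*(t)], which have the same length. *)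
Lemma lebesgue_xsection_rearrangement_hypograph f t :
  measurable_fun setT f -> (0 < t)%R ->
  lebesgue_measure (xsection (rearrangement_hypograph f) t) = rearrangement f t.
Proof.
move=> mf t0; set S := xsection _ _.
have SE s : S s <-> t%:E < mu (ysection (hypograph f) s).
  by rewrite /S /xsection /rearrangement_hypograph /= inE/= t0.
have mS : measurable S.
  by apply: measurable_xsection; exact: measurable_rearrangement_hypograph.
(* If s is in S, its superlevel set has measure above t; an admissible s' < s would have a larger
   superlevel set of measure at most t. *)
have le_S s : S s -> (0 <= s)%R /\ s%:E <= rearrangement f t.
  move=> /SE ts; have s0 : (0 <= s)%R.
    rewrite leNgt; apply/negP => s0; move: ts.
    by rewrite ysection_hypograph0// measure0 lte_fin ltNge ltW.
  split => //; apply: le_ereal_inf_tmp => _ [s' [s'0 ms'] <-].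
  rewrite lee_fin leNgt; apply/negP => s's.
  move: ts; rewrite ltNge => /negP; apply; apply: le_trans ms'.
  rewrite ysection_hypograph//.
  apply: le_measure; rewrite ?inE; try exact: measurable_superlevel.
  by move=> x /=; exact: lt_trans.
(* A nonnegative s below the infimum is not admissible, so its superlevel set has measure above
   t. *)
have lt_S s : (0 <= s)%R -> s%:E < rearrangement f t -> S s.
  move=> s0 sr; apply/SE; rewrite ltNge; apply/negP => st.
  move: sr; rewrite ltNge => /negP; apply; apply: ereal_inf_lbound.
  by exists s => //; split => //; rewrite -ysection_hypograph.
have := rearrangement_ge0 f t.
case: (rearrangement f t) le_S lt_S => [r| |//] le_S lt_S => [|_].
- rewrite lee_fin => r0; apply/eqP; rewrite eq_le; apply/andP; split.
  + apply: (@le_trans _ _ (lebesgue_measure (`[0%R, r]%classic : set R))).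
      apply: le_measure; rewrite ?inE//.
      by move=> s /le_S[s0 sr]; rewrite /= in_itv/= s0.
    by rewrite lebesgue_measure_itv/= lte_fin; case: ifPn; rewrite ?sube0.
  + apply: (@le_trans _ _ (lebesgue_measure (`[0%R, r[%classic : set R))).
      rewrite lebesgue_measure_itv/= lte_fin; case: ifPn; rewrite ?sube0//.
      by rewrite -leNgt lee_fin.
    apply: le_measure; rewrite ?inE//.
    by move=> s /=; rewrite in_itv/= => /andP[s0 sr]; exact: lt_S.
(* When f^*(t) = +oo, the section contains the whole half-line [0, +oo[. *)
- apply/eqP; rewrite -leye_eq.
  apply: (@le_trans _ _ (lebesgue_measure (`[0%R, +oo[%classic : set R))).
    by rewrite lebesgue_measure_itv/= ltry sube0.
  apply: le_measure; rewrite ?inE//.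
  by move=> s /=; rewrite in_itv/= andbT => s0; apply: lt_S => //; rewrite ltry.
Qed.

(** For t > 0 the rearrangement is the length of a section of a measurable set of the plane, and
    such lengths depend measurably on t. *)
Lemma measurable_rearrangement f : measurable_fun setT f ->
  measurable_fun (@Rpos R) (rearrangement f : Rleb R -> \bar R).
Proof.
move=> mf.
apply: (@eq_measurable_fun _ _ _ _ _ (leb \o xsection (rearrangement_hypograph f))).
  move=> t; rewrite inE RposE => t0.
  exact: lebesgue_xsection_rearrangement_hypograph.
apply: measurable_funTS; apply: measurable_fun_xsection.
exact: measurable_rearrangement_hypograph.
Qed.

(** Realises a measure m, finite or not, as the length of ]0, m[, which is empty when m = 0. *)
Lemma set_lt_itv (m : \bar R) : 0 <= m ->
  exists2 i : interval R, [set t | (0 < t)%R /\ t%:E < m] = [set` i] &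
                          lebesgue_measure ([set` i] : set R) = m.
Proof.
case: m => [r|_|//]; [rewrite lee_fin => r0; exists (`]0%R, r[) | exists (`]0%R, +oo[)].
- by apply/seteqP; split=> t /=; rewrite in_itv/= lte_fin => /andP.
- rewrite lebesgue_measure_itv/= lte_fin; case: ifPn; rewrite ?sube0//.
  by rewrite -leNgt => r0'; congr EFin; apply/eqP; rewrite eq_le r0 r0'.
- apply/seteqP; split=> t /=; rewrite in_itv/= andbT; first by case.
  by move=> t0; split=> //; rewrite ltry.
- by rewrite lebesgue_measure_itv/= ltry sube0.
Qed.

Lemma hardy_littlewood f g : measurable_fun setT f -> measurable_fun setT g ->
  \int[lebesgue_Rn]_x `|f x * g x|%:E <=
  \int[@completed_lebesgue_measure R]_(t in @Rpos R)
    (rearrangement f t * rearrangement g t).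
Proof.
move=> mf mg.
have mhf := measurable_hypograph mf; have mhg := measurable_hypograph mg.
have mrf := measurable_rearrangement_hypograph mf.
have mrg := measurable_rearrangement_hypograph mg.
rewrite (eq_integral (fun x => leb (xsection (hypograph f) x) *
    leb (xsection (hypograph g) x))); last first.
  move=> x _; rewrite normrM EFinM; congr (_ * _); apply/esym;
    exact: lebesgue_xsection_hypograph.
rewrite (integral_mul_xsection mu leb mhf mhg).
rewrite [leRHS](_ : _ = \int[cleb]_t (leb (xsection (rearrangement_hypograph f) t) *
    leb (xsection (rearrangement_hypograph g) t))); last first.
  (* For t <= 0 both integrands vanish: the left one by restriction, the right one because
     [rearrangement_hypograph] requires t > 0. *)
  rewrite integral_mkcond; apply: eq_integral => t _ /=.
  rewrite patchE; case: ifPn.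
    rewrite inE RposE => t0.
    by congr (_ * _); apply/esym; exact: lebesgue_xsection_rearrangement_hypograph.
  rewrite notin_setE RposE => /negP t0.
  rewrite (_ : xsection _ _ = set0) ?measure0 ?mul0e//.
  by apply/seteqP; split=> // s; rewrite /xsection /rearrangement_hypograph/= inE/= (negbTE t0).
rewrite (integral_mul_xsection cleb leb mrf mrg).
apply: ge0_le_integral => //.
- exact: measurable_fun_ysectionI.
- exact: measurable_fun_ysectionI.
(* The interval ]0, m[ has length m and lies in both sections, since m is at most the measure of
   either hypograph section. *)
- move=> [s s'] _ /=; set m := mu _.
  have [i itvE <-] := set_lt_itv (measure_ge0 mu _ : 0 <= m).
  apply: (@le_measure _ _ _ cleb); rewrite ?inE.
  + exact: measurable_itv_Rleb.
  + by apply: measurableI; exact: measurable_ysection.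
  + rewrite -itvE => t /= [t0 tm]; split.
    * rewrite /ysection /rearrangement_hypograph/= inE/= t0/=.
      apply: lt_le_trans tm _; apply: le_measure; rewrite ?inE//.
      - by apply: measurableI; exact: measurable_ysection.
      - exact: measurable_ysection.
    * rewrite /ysection /rearrangement_hypograph/= inE/= t0/=.
      apply: lt_le_trans tm _; apply: le_measure; rewrite ?inE//.
      - by apply: measurableI; exact: measurable_ysection.
      - exact: measurable_ysection.
Qed.

End rearrangement_section.

(** * The case of modulars at most 1 *)

Section normalised_hoelder.
Context {R : realType} {n : nat}.
Implicit Types (p q : R -> R) (f g : Rn R n -> R).
Local Open Scope ereal_scope.

Let cleb : {measure set (Rleb R) -> \bar R} := @completed_lebesgue_measure R.

Definition lorentz_integrand p q f (t : R) : \bar R :=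
  (t `^ (q t / p t - 1))%R%:E * (rearrangement f t) `^ (q t).

Lemma lorentz_integrand_ge0 p q f t : 0 <= lorentz_integrand p q f t.
Proof. by apply: mule_ge0; rewrite ?lee_fin ?powR_ge0 ?poweR_ge0. Qed.

Lemma measurable_conjugate_exponent p :
  measurable_fun (@Rpos R) (p : Rleb R -> R) ->
  measurable_fun (@Rpos R) (conjugate_exponent p : Rleb R -> R).
Proof.
move=> mp; apply: measurable_fun_inv; apply: measurable_funB.
  exact: measurable_cst.
exact: measurable_fun_inv.
Qed.

Lemma measurable_lorentz_integrand p q f :
  measurable_fun (@Rpos R) (p : Rleb R -> R) ->
  measurable_fun (@Rpos R) (q : Rleb R -> R) ->
  measurable_fun setT f ->
  measurable_fun (@Rpos R) (lorentz_integrand p q f : Rleb R -> \bar R).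
Proof.
move=> mp mq mf; apply: emeasurable_funM.
- apply/measurable_EFinP; apply: measurable_fun_powR.
    exact/measurable_funTS/measurable_id_Rleb.
  apply: measurable_funB; last exact: measurable_cst.
  apply: measurable_funM; [exact: mq|exact: measurable_fun_inv].
- apply: measurable_fun_poweR => //; exact: measurable_rearrangement.
Qed.

(** The restricted measure of N is the measure of N intersected with [Rpos], so that intersection is
    the null set required. *)
Lemma ae_Rpos (P : R -> Prop) :
  (\forall t \ae @lebesgue_pos R, P (t : R)) ->
  \forall t \ae cleb, Rpos t -> P t.
Proof.
move=> [N [mN N0 PN]]; exists (N `&` Rpos); split.
- by apply: measurableI => //; exact: measurable_Rpos.
- exact: N0.
- move=> t /= /not_implyP[tpos nPt]; split=> //; exact: PN.
Qed.

(** The chain 1 < q_- <= q_+ < +oo makes both essential bounds finite, so [fine] preserves them. *)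
Lemma exponent_bounds q : exponent_class 1 q ->
  let qm := fine (exponent_inf q) in let qp := fine (exponent_sup q) in
  [/\ (1 < qm)%R, (qm <= qp)%R &
      \forall t \ae cleb, Rpos t -> (qm <= q t <= qp)%R].
Proof.
move=> [_ q1 qmp qpoo] qm qp.
have infE : exponent_inf q = qm%:E.
  by rewrite fineK// fin_numE gt_eqF ?lt_eqF ?(le_lt_trans qmp)// (lt_trans _ q1)// ltNyr.
have supE : exponent_sup q = qp%:E.
  by rewrite fineK// fin_numE gt_eqF ?lt_eqF// (lt_le_trans _ qmp)// (lt_trans _ q1)// ltNyr.
split.
- by rewrite -lte_fin -infE.
- by rewrite -lee_fin -infE -supE.
- apply: (@ae_Rpos (fun t => (qm <= q t <= qp)%R)).
  have /= := @ess_inf_le _ _ _ (@lebesgue_pos R) (fun t : Rleb R => (q t)%:E).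
  apply: filterS2 (@ess_sup_ge _ _ _ (@lebesgue_pos R) (fun t : Rleb R => (q t)%:E)).
  move=> t; rewrite -/(exponent_sup q) -/(exponent_inf q) infE supE !lee_fin.
  by move=> -> ->.
Qed.

Lemma normalised_hoelder p q f g :
  measurable_fun (@Rpos R) (p : Rleb R -> R) -> exponent_class 1 q ->
  measurable_fun setT f -> measurable_fun setT g ->
  lorentz_modular (conjugate_exponent p) (conjugate_exponent q) f <= 1 ->
  lorentz_modular p q g <= 1 ->
  \int[lebesgue_Rn]_x `|f x * g x|%:E <=
  (1 + (fine (exponent_inf q))^-1 - (fine (exponent_sup q))^-1)%:E.
Proof.
move=> mp qE mf mg rf rg; apply: le_trans (hardy_littlewood mf mg) _.
have [qm1 qmp qb] := exponent_bounds qE.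
have mq : measurable_fun (@Rpos R) (q : Rleb R -> R) by case: qE => -[].
set qm := fine (exponent_inf q) in qm1 qmp qb *.
set qp := fine (exponent_sup q) in qmp qb *.
have qm0 : (0 < qm)%R by exact: lt_trans qm1.
have qp1 : (1 < qp)%R by exact: lt_le_trans qmp.
have iqm : 0 <= (qm^-1)%:E by rewrite lee_fin invr_ge0 ltW.
have iqp : 0 <= (1 - qp^-1)%:E by rewrite lee_fin subr_ge0 invf_le1 ?ltW// (lt_trans _ qp1).
pose Lg := lorentz_integrand p q g.
pose Lf := lorentz_integrand (conjugate_exponent p) (conjugate_exponent q) f.
have mLg : measurable_fun (@Rpos R) (Lg : Rleb R -> \bar R).
  exact: measurable_lorentz_integrand.
have mLf : measurable_fun (@Rpos R) (Lf : Rleb R -> \bar R).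
  by apply: measurable_lorentz_integrand => //; exact: measurable_conjugate_exponent.
have Lg0 t : 0 <= Lg t by exact: lorentz_integrand_ge0.
have Lf0 t : 0 <= Lf t by exact: lorentz_integrand_ge0.
have mZg : measurable_fun (@Rpos R) ((fun t => (qm^-1)%:E * Lg t) : Rleb R -> \bar R).
  exact: measurable_funeM.
have mZf : measurable_fun (@Rpos R) ((fun t => (1 - qp^-1)%:E * Lf t) : Rleb R -> \bar R).
  exact: measurable_funeM.
have Zg0 t : 0 <= (qm^-1)%:E * Lg t.
  exact: mule_ge0.
have Zf0 t : 0 <= (1 - qp^-1)%:E * Lf t by exact: mule_ge0.
have mR := @measurable_Rpos R.
apply: (@le_trans _ _ (\int[cleb]_(t in @Rpos R)
    ((qm^-1)%:E * Lg t + (1 - qp^-1)%:E * Lf t))).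
  apply: (@ae_ge0_le_integral _ _ _ cleb _ mR).
  - by move=> t _; apply: mule_ge0; exact: rearrangement_ge0.
  - by apply: emeasurable_funM; exact: measurable_rearrangement.
  - by move=> t _; exact: adde_ge0.
  - exact: emeasurable_funD.
  (* At almost every t > 0, Young with the constants p(t), q(t) applies; then q_- <= q(t) <= q_+
     bounds 1/q(t) by 1/q_- and 1 - 1/q(t) by 1 - 1/q_+. *)
  - apply: filterS qb => t qb tpos; have /andP[qmt qtp] := qb tpos.
    have t0 : (0 < t :> R)%R by rewrite -RposE.
    have qt1 : (1 < q t)%R by exact: lt_le_trans qmt.
    have qt0 : (0 < q t)%R by exact: lt_trans qt1.
    apply: le_trans (weighted_young_ereal (p t) t0 qt1
      (rearrangement_ge0 g t) (rearrangement_ge0 f t)) _.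
    apply: leeD.
    + by apply: (lee_wpmul2r (Lg0 t)); rewrite lee_fin lef_pV2.
    + apply: (lee_wpmul2r (Lf0 t)).
      by rewrite lee_fin lerD2l lerN2 lef_pV2 // posrE (lt_trans _ qp1).
rewrite (@ge0_integralD _ _ _ cleb _ mR _ _ (fun t _ => Zg0 t) mZg (fun t _ => Zf0 t) mZf).
rewrite (@ge0_integralZl _ _ _ cleb _ mR _ mLg _ (fun t _ => Lg0 t) iqm).
rewrite (@ge0_integralZl _ _ _ cleb _ mR _ mLf _ (fun t _ => Lf0 t) iqp).
have -> : (1 + qm^-1 - qp^-1 = qm^-1 + (1 - qp^-1))%R by lra.
rewrite [leRHS]EFinD; apply: leeD.
- by rewrite -[leRHS]mule1; exact: lee_wpmul2l.
- by rewrite -[leRHS]mule1; exact: lee_wpmul2l.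
Qed.

End normalised_hoelder.

(** * Scaling of rearrangements and modulars *)

Section scaling.
Context {R : realType} {n : nat}.
Implicit Types (p q : R -> R) (f g : Rn R n -> R).
Local Open Scope ereal_scope.

Let cleb : {measure set (Rleb R) -> \bar R} := @completed_lebesgue_measure R.

(** If s is admissible for f, then s/l is admissible for f/l, the two superlevel sets being
    equal. *)
Lemma rearrangement_div f (l t : R) : (0 < l)%R ->
  rearrangement (fun x => f x / l)%R t <= (l^-1)%:E * rearrangement f t.
Proof.
move=> l0; rewrite lee_pdivlMl//.
apply: le_ereal_inf_tmp => _ [s [s0 ms] <-].
rewrite -lee_pdivlMl// -EFinM; apply: ereal_inf_lbound.
exists (l^-1 * s)%R => //; split; first by rewrite mulr_ge0// invr_ge0 ltW.
rewrite (_ : [set x | _] = [set x | (s < `|f x|)%R])//.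
apply/seteqP; split=> x /=; rewrite normrM normfV (gtr0_norm l0);
  by rewrite mulrC ltr_pM2r// invr_gt0.
Qed.

Lemma measurable_fun_div f (l : R) : measurable_fun setT f ->
  measurable_fun setT (fun x => f x / l)%R.
Proof. by move=> mf; apply: measurable_funM => //; exact: measurable_cst. Qed.

(** Since 1/l <= 1 and q(t) >= 1, the factor (1/l)^q(t) is at most 1/l. *)
Lemma lorentz_integrand_div p q f (l t : R) : (1 <= l)%R -> (1 <= q t)%R ->
  lorentz_integrand p q (fun x => f x / l)%R t <=
  (l^-1)%:E * lorentz_integrand p q f t.
Proof.
move=> l1 q1; have l0 : (0 < l)%R by exact: lt_le_trans l1.
have q0 : (0 <= q t)%R by exact: le_trans q1.
rewrite /lorentz_integrand muleCA; apply: lee_wpmul2l.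
  by rewrite lee_fin powR_ge0.
have r0 h := @rearrangement_ge0 _ n h t.
have il0 : 0 <= (l^-1)%:E by rewrite lee_fin invr_ge0 ltW.
apply: (@le_trans _ _ (((l^-1)%:E * rearrangement f t) `^ (q t))).
  apply: gt0_ler_poweR => //; rewrite ?in_itv/= ?leey ?andbT ?mule_ge0//.
  exact: rearrangement_div.
rewrite poweRM//; apply: lee_wpmul2r; first exact: poweR_ge0.
rewrite lee_fin; apply: ge1r_powR => //.
by rewrite invr_gt0 l0 invf_le1.
Qed.

(** Shows that the infimum defining the norm runs over a nonempty set, so that the norm is
    finite. *)
Lemma lorentz_modular_div_le1 p q f :
  measurable_fun (@Rpos R) (p : Rleb R -> R) ->
  measurable_fun (@Rpos R) (q : Rleb R -> R) ->
  (\forall t \ae cleb, Rpos t -> (1 <= q t)%R) ->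
  variable_lorentz p q f ->
  exists2 l : R, (0 < l)%R & lorentz_modular p q (fun x => f x / l)%R <= 1.
Proof.
move=> mp mq q1 [mf foo].
pose M := lorentz_modular p q f.
have M0 : 0 <= M by apply: integral_ge0 => t _; exact: lorentz_integrand_ge0.
have Mfin : M \is a fin_num by rewrite ge0_fin_numE.
(* The modular of f/l is at most M/l, hence at most 1 since l >= M; the bound l >= 1 is what the
   pointwise scaling requires. *)
pose l := Num.max 1%R (fine M).
have l1 : (1 <= l)%R by rewrite le_max lexx.
have l0 : (0 < l)%R by exact: lt_le_trans l1.
exists l => //.
have mL : measurable_fun (@Rpos R) (lorentz_integrand p q f : Rleb R -> \bar R).
  exact: measurable_lorentz_integrand.
have L0 h t : 0 <= @lorentz_integrand _ n p q h t by exact: lorentz_integrand_ge0.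
have il0 : 0 <= (l^-1)%:E by rewrite lee_fin invr_ge0 ltW.
apply: (@le_trans _ _ (\int[cleb]_(t in @Rpos R)
    ((l^-1)%:E * lorentz_integrand p q f t))).
  apply: (@ae_ge0_le_integral _ _ _ cleb _ (@measurable_Rpos R)).
  - by move=> t _; exact: (L0 (fun x => f x / l)%R).
  - by apply: measurable_lorentz_integrand => //; exact: measurable_fun_div.
  - by move=> t _; exact: mule_ge0.
  - exact: measurable_funeM.
  - by apply: filterS q1 => t q1 /q1; exact: lorentz_integrand_div.
rewrite (@ge0_integralZl _ _ _ cleb _ (@measurable_Rpos R) _ mL _ (fun t _ => L0 f t) il0).
rewrite lee_pdivrMl// mule1 -[leLHS]/M -(fineK Mfin) lee_fin.
by rewrite le_max lexx orbT.
Qed.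

Lemma conjugate_exponent_ge1 q (t : R) : (1 < q t)%R ->
  (1 <= conjugate_exponent q t)%R.
Proof.
move=> q1; have q0 : (0 < q t)%R by exact: lt_trans q1.
rewrite /conjugate_exponent -[leLHS]invr1 lef_pV2 ?posrE ?subr_gt0 ?invf_lt1//.
by rewrite lerBlDr lerDl invr_ge0 ltW.
Qed.

(** Write |f g| = l m |(f/l) (g/m)| and apply the normalised inequality to f/l and g/m. *)
Lemma hoelder_scaled p q f g (l m : R) :
  measurable_fun (@Rpos R) (p : Rleb R -> R) -> exponent_class 1 q ->
  measurable_fun setT f -> measurable_fun setT g -> (0 < l)%R -> (0 < m)%R ->
  lorentz_modular (conjugate_exponent p) (conjugate_exponent q)
    (fun x => f x / l)%R <= 1 ->
  lorentz_modular p q (fun x => g x / m)%R <= 1 ->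
  \int[lebesgue_Rn]_x `|f x * g x|%:E <=
  (1 + (fine (exponent_inf q))^-1 - (fine (exponent_sup q))^-1)%:E * l%:E * m%:E.
Proof.
move=> mp qE mf mg l0 m0 rf rg.
have mfl := measurable_fun_div l mf; have mgm := measurable_fun_div m mg.
rewrite (eq_integral (fun x => (l * m)%:E * `|(f x / l) * (g x / m)|%:E)); last first.
  move=> x _; rewrite -EFinM; congr EFin.
  rewrite -{1}(gtr0_norm (mulr_gt0 l0 m0)) -normrM; congr (`|_|)%R.
  by field; rewrite !gt_eqF.
have lm0 : 0 <= (l * m)%:E by rewrite lee_fin ltW// mulr_gt0.
have mI : measurable_fun setT (fun x => `|(f x / l) * (g x / m)|%:E).
  apply/measurable_EFinP.
  apply: (@measurableT_comp _ _ _ _ _ _ (@Num.norm R R)) => //.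
  exact: measurable_funM.
rewrite (ge0_integralZl _ measurableT mI _ lm0); last first.
  by move=> x _; rewrite lee_fin.
rewrite -muleA -(EFinM l m) [leRHS]muleC; apply: lee_wpmul2l => //.
exact: (normalised_hoelder mp qE mfl mgm rf rg).
Qed.

Lemma lorentz_norm_ge0 p q f : 0 <= lorentz_norm p q f.
Proof. by apply: le_ereal_inf_tmp => _ [l [/ltW l0 _] <-]; rewrite lee_fin. Qed.

End scaling.

(** * Passage to the norms *)

Unset Implicit Arguments.

Theorem theorem6 (R : realType) (n : nat) (hn : (0 < n)%N) (p q : R -> R)
    (hp : exponent_class 1 p) (hq : exponent_class 1 q)
    (f g : Rn R n -> R)
    (hf : variable_lorentz (conjugate_exponent p) (conjugate_exponent q) f)
    (hg : variable_lorentz p q g) :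
  (\int[lebesgue_Rn]_x (`|f x * g x|)%:E <=
   (1 + (fine (exponent_inf q))^-1 - (fine (exponent_sup q))^-1)%:E
   * lorentz_norm (conjugate_exponent p) (conjugate_exponent q) f
   * lorentz_norm p q g)%E.
Proof.
have mp : measurable_fun (@Rpos R) (p : Rleb R -> R) by case: hp => -[].
have mq : measurable_fun (@Rpos R) (q : Rleb R -> R) by case: hq => -[].
have [qm1 qmp qb] := exponent_bounds hq.
have mf := proj1 hf; have mg := proj1 hg.
have scaled := @hoelder_scaled _ _ p q f g _ _ mp hq mf mg.
set C := (1 + _ - _) in scaled *.
(* C is the sum of 1 - 1/q_+ and 1/q_-, both positive; positivity allows division by C below. *)
have C0 : 0 < C.
  have qp1 := lt_le_trans qm1 qmp.
  rewrite /C addrAC addr_gt0//; last by rewrite invr_gt0; exact: lt_trans qm1.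
  by rewrite subr_gt0 invf_lt1//; exact: lt_trans qp1.
have [l l0 rl] : exists2 l : R, 0 < l &
    (lorentz_modular (conjugate_exponent p) (conjugate_exponent q)
      (fun x => f x / l)%R <= 1)%E.
  apply: lorentz_modular_div_le1 => //; try exact: measurable_conjugate_exponent.
  apply: filterS qb => t qb /qb/andP[qmt _].
  by apply: conjugate_exponent_ge1; exact: lt_le_trans qmt.
have [m m0 rm] : exists2 m : R, 0 < m &
    (lorentz_modular p q (fun x => g x / m)%R <= 1)%E.
  apply: lorentz_modular_div_le1 => //.
  apply: filterS qb => t qb /qb/andP[qmt _].
  by apply: le_trans qmt; exact: ltW.
set I := (X in (X <= _)%E) in scaled *.
set N := lorentz_norm _ _ f.
have Nfin : N \is a fin_num.
  rewrite ge0_fin_numE ?lorentz_norm_ge0//; apply: (@le_lt_trans _ _ l%:E).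
    by apply: ereal_inf_lbound; exists l.
  exact: ltry.
(* With the scale k of g fixed, dividing by C k and taking the infimum over the scales j of f
   replaces j by the norm N. *)
have INm k : 0 < k ->
    (lorentz_modular p q (fun x => g x / k)%R <= 1 -> I <= C%:E * N * k%:E)%E.
  move=> k0 rk; rewrite muleAC -EFinM -lee_pdivrMl ?mulr_gt0//.
  apply: le_ereal_inf_tmp => _ [j [j0 rj] <-].
  by rewrite lee_pdivrMl ?mulr_gt0// EFinM muleAC; exact: scaled.
have := lorentz_norm_ge0 (conjugate_exponent p) (conjugate_exponent q) f.
rewrite -/N -(fineK Nfin) in INm *; rewrite lee_fin le_eqVlt => /predU1P[N0|N0].
  (* If N = 0, division by C N is impossible, but the single admissible scale m already gives I <=
     0. *)
  by have := INm _ m0 rm; rewrite -N0 !mule0 !mul0e.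
(* If N > 0, divide by C N and take the infimum over the scales k of g. *)
rewrite -EFinM -lee_pdivrMl ?mulr_gt0//.
apply: le_ereal_inf_tmp => _ [k [k0 rk] <-].
by rewrite lee_pdivrMl ?mulr_gt0// EFinM; exact: INm.
Qed.
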